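(* Let $\epsilon$ be a primitive cube root of unity and let $F=\mathbb{Q}(\epsilon)$ be the third cyclotomic field. Let $\alpha$ be a nonzero cubefree rational integer not equal to one, and let $K=F(\sqrt[3]{\alpha})$ be the corresponding Kummer field. Let $p$ and $q$ be distinct odd positive primes such that $\left(\frac{q}{p}\right)\neq 1$ and $p\equiv q\equiv 3\pmod 4$. Then the quaternion algebra $H_K(p,q)$ is a division algebra if and only if $\left(\frac{-3}{p}\right)=1$.
   Context: For a field $F$ of characteristic $\neq 2$ and $a,b\in F\setminus\{0\}$, $H_F(a,b)$ denotes the generalized quaternion algebra over $F$ with basis $1,i,j,k$ and relations $i^2=a$, $j^2=b$, $ij=-ji=k$. $\left(\frac{m}{\ell}\right)$ is the Legendre symbol for an odd prime $\ell$, equal to $0$ if $\ell\mid m$. *)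

(* Defs.v *)
From HB Require Import structures.
From mathcomp Require Import all_boot all_order all_algebra all_field.
From mathcomp Require Import ring.

Set Implicit Arguments.
Unset Strict Implicit.
Unset Printing Implicit Defensive.

Import GRing.Theory.

Local Open Scope ring_scope.

(* This makes sense for all a and b; it is the generalized quaternion algebra
   H_F(a, b) when a, b != 0 and the characteristic of F is not 2. *)
Record quaternion (F : fieldType) (a b : F) : Type :=
  Quaternion { quat_1 : F; quat_i : F; quat_j : F; quat_k : F }.

Section QuaternionAlgebra.

Variables (F : fieldType) (a b : F).

Local Notation H := (quaternion a b).

Implicit Types x y z : H.

Definition quat_to_row x : 'rV[F]_4 :=
  \row_n nth 0 [:: quat_1 x; quat_i x; quat_j x; quat_k x] n.

Definition quat_of_row (v : 'rV[F]_4) : H :=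
  Quaternion a b (v 0 (inord 0)) (v 0 (inord 1)) (v 0 (inord 2))
    (v 0 (inord 3)).

Fact quat_to_rowK : cancel quat_to_row quat_of_row.
Proof.
by case=> x1 xi xj xk; rewrite /quat_of_row !mxE /= !inordK.
Qed.

Fact quat_of_rowK : cancel quat_of_row quat_to_row.
Proof.
move=> v; apply/rowP=> n; rewrite mxE /=.
by case: n => -[|[|[|[|//]]]] lt_n4 /=; congr (v 0 _); apply: val_inj;
  rewrite /= inordK.
Qed.

HB.instance Definition _ := Choice.copy H (can_type quat_to_rowK).

Definition quat_zero : H := Quaternion a b 0 0 0 0.

Definition quat_opp x : H :=
  Quaternion a b (- quat_1 x) (- quat_i x) (- quat_j x) (- quat_k x).

Definition quat_add x y : H :=
  Quaternion a b (quat_1 x + quat_1 y) (quat_i x + quat_i y)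
    (quat_j x + quat_j y) (quat_k x + quat_k y).

Definition quat_scale (c : F) x : H :=
  Quaternion a b (c * quat_1 x) (c * quat_i x) (c * quat_j x) (c * quat_k x).

Definition quat_one : H := Quaternion a b 1 0 0 0.

(* Bilinear extension of i * i = a, j * j = b, i * j = k, j * i = - k, whence
   k * k = - (a * b), i * k = a * j, k * i = - a * j, k * j = b * i,
   j * k = - b * i. *)
Definition quat_mul x y : H :=
  let: Quaternion x1 xi xj xk := x in
  let: Quaternion y1 yi yj yk := y in
  Quaternion a b
    (x1 * y1 + a * (xi * yi) + b * (xj * yj) - a * b * (xk * yk))
    (x1 * yi + xi * y1 - b * (xj * yk) + b * (xk * yj))
    (x1 * yj + xj * y1 + a * (xi * yk) - a * (xk * yi))
    (x1 * yk + xk * y1 + xi * yj - xj * yi).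

Local Ltac quat_ring :=
  repeat case=> ? ? ? ?;
  rewrite /quat_mul /quat_add /quat_opp /quat_scale /=; congr Quaternion; ring.

Fact quat_addA : associative quat_add. Proof. quat_ring. Qed.
Fact quat_addC : commutative quat_add. Proof. quat_ring. Qed.
Fact quat_add0 : left_id quat_zero quat_add. Proof. quat_ring. Qed.
Fact quat_addN : left_inverse quat_zero quat_opp quat_add.
Proof. quat_ring. Qed.

HB.instance Definition _ :=
  GRing.isZmodule.Build H quat_addA quat_addC quat_add0 quat_addN.

Fact quat_mulA : associative quat_mul. Proof. quat_ring. Qed.
Fact quat_mul1 : left_id quat_one quat_mul. Proof. quat_ring. Qed.
Fact quat_mulr1 : right_id quat_one quat_mul. Proof. quat_ring. Qed.
Fact quat_mulDl : left_distributive quat_mul quat_add. Proof. quat_ring. Qed.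
Fact quat_mulDr : right_distributive quat_mul quat_add. Proof. quat_ring. Qed.
Fact quat_one_neq0 : quat_one != 0.
Proof. by apply/eqP=> -[] /eqP; rewrite oner_eq0. Qed.

HB.instance Definition _ := GRing.Zmodule_isNzRing.Build H
  quat_mulA quat_mul1 quat_mulr1 quat_mulDl quat_mulDr quat_one_neq0.

Fact quat_scaleA c d x : quat_scale c (quat_scale d x) = quat_scale (c * d) x.
Proof. by move: x; quat_ring. Qed.
Fact quat_scale1 : left_id 1 quat_scale. Proof. quat_ring. Qed.
Fact quat_scaleDr : right_distributive quat_scale quat_add.
Proof. by move=> c; quat_ring. Qed.
Fact quat_scaleDl x c d :
  quat_scale (c + d) x = quat_add (quat_scale c x) (quat_scale d x).
Proof. by move: x; quat_ring. Qed.

HB.instance Definition _ := GRing.Zmodule_isLmodule.Build F H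
  quat_scaleA quat_scale1 quat_scaleDr quat_scaleDl.

Fact quat_scaleAl (c : F) x y :
  quat_scale c (quat_mul x y) = quat_mul (quat_scale c x) y.
Proof. by move: x y; quat_ring. Qed.
Fact quat_scaleAr (c : F) x y :
  quat_scale c (quat_mul x y) = quat_mul x (quat_scale c y).
Proof. by move: x y; quat_ring. Qed.

HB.instance Definition _ := GRing.Lmodule_isLalgebra.Build F H quat_scaleAl.
HB.instance Definition _ := GRing.Lalgebra_isAlgebra.Build F H quat_scaleAr.

Fact quat_vect_iso : Vector.axiom 4 H.
Proof.
exists quat_to_row; last by exists quat_of_row;
  [exact: quat_to_rowK | exact: quat_of_rowK].
move=> c x y; apply/rowP=> n; rewrite !mxE.
by case: n => -[|[|[|[|//]]]] lt_n4.
Qed.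

HB.instance Definition _ := Lmodule_hasFinDim.Build F H quat_vect_iso.
HB.instance Definition _ := Algebra_isFalgebra.Build F H.

Definition qi : H := Quaternion a b 0 1 0 0.
Definition qj : H := Quaternion a b 0 0 1 0.
Definition qk : H := Quaternion a b 0 0 0 1.

Lemma qi_sqr : qi ^+ 2 = a%:A.
Proof. by rewrite expr2; congr Quaternion => /=; ring. Qed.

Lemma qj_sqr : qj ^+ 2 = b%:A.
Proof. by rewrite expr2; congr Quaternion => /=; ring. Qed.

Lemma qi_qj : qi * qj = qk.
Proof. by congr Quaternion => /=; ring. Qed.

Lemma qj_qi : qj * qi = - qk.
Proof. by congr Quaternion => /=; ring. Qed.

Lemma quatE x :
  x = (quat_1 x)%:A + quat_i x *: qi + quat_j x *: qj + quat_k x *: qk.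
Proof. by case: x => x1 xi xj xk; congr Quaternion => /=; ring. Qed.

Lemma quat_basis : basis_of fullv ([:: 1; qi; qj; qk] : seq H).
Proof.
set s : seq H := [:: _; _; _; _]; rewrite basisEdim dimvf /dim /= andbT.
have mem v : v \in s -> v \in <<s>>%VS by exact: memv_span.
apply/subvP=> x _; rewrite (quatE x).
by do 3?[apply: memvD]; apply/memvZ/mem; rewrite !inE eqxx ?orbT.
Qed.

End QuaternionAlgebra.

(* Nontriviality, 1 != 0, is part of falgType. *)
Definition division_algebra (F : fieldType) (A : falgType F) : Prop :=
  forall x : A, x != 0 -> x \is a GRing.unit.

(* Meaningful for l an odd prime, for which 'F_l is the field Z/lZ. *)
Definition legendre (m : int) (l : nat) : int :=
  if (l%:Z %| m)%Z then 0
  else if [exists x : 'F_l, x ^+ 2 == m%:~R] then 1 else -1.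

Definition cubefree (n : int) : Prop :=
  forall l : nat, prime l -> ~~ (l%:Z ^+ 3 %| n)%Z.

(* Main.v *)
Require Import Defs.
From mathcomp Require Import all_boot all_order all_algebra all_field.
From mathcomp Require Import zify ring.
Import Order.TTheory GRing.Theory Num.Theory.

Set Implicit Arguments.
Unset Strict Implicit.
Unset Printing Implicit Defensive.

Local Open Scope ring_scope.

(* H_K(a, b) is a division algebra iff z^2 = a x^2 + b y^2 has no nontrivial
   solution in K.  Since [K : F] is 1 or 3, Springer's argument reduces this to
   F = Q(sqrt(-3)).

   If (-3/p) = 1, then p splits in Z[sqrt(-3)]; as q is not a square modulo p,
   a solution can be divided forever by a prime above p.

   If (-3/p) <> 1, then 3 is a square modulo p, and Thue's lemma gives integers
   with a^2 - 3 e^2 = -p or -2p.  In F, both a^2 - 3 e^2 and -1 = w + w^2 =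
   (w^2)^2 + w^2 are sums of two squares, hence so is p = u^2 + v^2.  By quadratic
   reciprocity p is a square modulo q, and -q is one modulo p, so that
   p X^2 = Z^2 + q Y^2 has a nontrivial rational solution.  Thus -1 and -q are
   both norms from F(sqrt p), hence so is q. *)

(** * Quaternion algebras and ternary forms *)

(** A zero of the ternary form makes [z + x i + y j] times its conjugate vanish, so a division
    algebra has no nontrivial zero. Conversely [x] is inverted by its conjugate over its norm [n],
    and a nontrivial zero of the norm form yields one of the ternary form. *)
Lemma quaternion_division_anisotropic (F : fieldType) (a b : F) :
  division_algebra (quaternion a b) <->
  (forall x y z : F, z ^+ 2 = a * x ^+ 2 + b * y ^+ 2 ->
    [/\ x = 0, y = 0 & z = 0]).
Proof.
split=> [divH x y z xyz | aniso].
  pose u : quaternion a b := Quaternion a b z x y 0.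
  pose v : quaternion a b := Quaternion a b z (- x) (- y) 0.
  have uv0 : u * v = 0.
    have zE : z * z = a * (x * x) + b * (y * y) by rewrite -!expr2.
    by congr Quaternion => /=; rewrite ?zE; ring.
  have [u0 | /divH uU] := eqVneq u 0.
    by case: u0 => -> -> ->.
  have : v = 0 by rewrite -[v](mulKr uU) uv0 mulr0.
  by case=> -> /eqP + /eqP; rewrite !oppr_eq0 => /eqP -> /eqP ->.
case=> x1 xi xj xk x0.
pose n := x1 ^+ 2 - a * xi ^+ 2 - b * xj ^+ 2 + a * b * xk ^+ 2.
have n0 : n != 0.
  apply: contra_neq x0 => n0.
  (* With D the left side, n = 0 reads x1^2 - a xi^2 = b D. Multiplying by D and using that norms
     from F(sqrt a) are multiplicative gives a zero of the ternary form with y = D. *)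
  have D0 : xj ^+ 2 - a * xk ^+ 2 = 0.
    have [] := aniso (x1 * xk + xi * xj) (xj ^+ 2 - a * xk ^+ 2)
      (x1 * xj + a * xi * xk) => //.
    apply/eqP; rewrite -subr_eq0; apply/eqP.
    transitivity (n * (xj ^+ 2 - a * xk ^+ 2)); last by rewrite n0 mul0r.
    by rewrite /n; ring.
  have [xk0 _ xj0] : [/\ xk = 0, 0 = 0 :> F & xj = 0].
    by apply: aniso; move/subr0_eq: D0 ->; ring.
  have [-> _ ->] : [/\ xi = 0, 0 = 0 :> F & x1 = 0].
    apply: aniso; apply/eqP; rewrite -subr_eq0 -[X in _ == X]n0 /n xk0 xj0.
    by apply/eqP; ring.
  by rewrite xk0 xj0.
pose c : quaternion a b := Quaternion a b x1 (- xi) (- xj) (- xk).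
apply/unitrP; exists (n^-1 *: c).
rewrite -scalerAl -scalerAr.
suff [-> ->] : c * Quaternion a b x1 xi xj xk = n%:A /\ Quaternion a b x1 xi xj xk * c = n%:A.
  by rewrite scalerA mulVf // scale1r.
by split; congr Quaternion => /=; rewrite /n; ring.
Qed.

(** Membership is a predicate on the ambient ring, so that a tower of subfields needs no change of
    type. *)
Definition anisotropic_on (R : nzRingType) (S : {pred R}) (a b : R) :=
  forall x y z, x \in S -> y \in S -> z \in S ->
    z ^+ 2 = a * x ^+ 2 + b * y ^+ 2 -> [/\ x = 0, y = 0 & z = 0].

Lemma anisotropic_morph (E L : fieldType) (f : {rmorphism E -> L}) (S : {pred L}) (a b : nat) :
  (forall y, reflect (exists x, y = f x) (y \in S)) ->
  (forall x y z : E, z ^+ 2 = a%:R * x ^+ 2 + b%:R * y ^+ 2 -> [/\ x = 0, y = 0 & z = 0])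
  <-> anisotropic_on S (a%:R : L) b%:R.
Proof.
move=> imf; split=> aniso.
  move=> _ _ _ /imf[x ->] /imf[y ->] /imf[z ->] xyz.
  have [|-> -> ->] := aniso x y z; last by rewrite rmorph0.
  by apply: (fmorph_inj f); rewrite rmorphD !rmorphM !rmorph_nat.
move=> x y z xyz; have fS w : f w \in S by apply/imf; exists w.
have [] := aniso (f x) (f y) (f z) => //.
  by rewrite -rmorphXn xyz rmorphD !rmorphM !rmorph_nat.
by move=> /eqP + /eqP + /eqP; rewrite !fmorph_eq0 => /eqP x0 /eqP y0 /eqP z0.
Qed.

Lemma quaternion_subvs_division (F0 : fieldType) (L : fieldExtType F0) (K : {subfield L}) (a b : nat) :
  division_algebra (quaternion (a%:R : subvs_of K) b%:R) <->
  anisotropic_on (mem K) (a%:R : L) b%:R.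
Proof.
rewrite quaternion_division_anisotropic.
apply: (anisotropic_morph (f := GRing.RMorphism.clone _ _ (vsval : subvs_of K -> L) _)).
move=> y; apply: (iffP idP) => [yK | [x ->]]; first by exists (Subvs yK).
exact: subvsP.
Qed.

(** * Springer's theorem for pure cubic extensions *)

Section Springer.

Variables (F0 : fieldType) (L : fieldExtType F0) (F : {subfield L}) (a b t : L).
Hypotheses (aF : a \in F) (bF : b \in F).
Hypothesis aniso : anisotropic_on (mem F) a b.

Lemma polyOver_coef (P : {poly L}) i : P \is a polyOver F -> P`_i \in F.
Proof. by move/polyOverP. Qed.

Let form (X Y Z : {poly L}) := Z ^+ 2 - a%:P * X ^+ 2 - b%:P * Y ^+ 2.

Lemma coef_sqr_top (P : {poly L}) n : (size P <= n.+1)%N -> (P ^+ 2)`_(n + n) = P`_n ^+ 2.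
Proof.
move=> sP; rewrite expr2 coefM (bigD1 (Ordinal (leq_addr n n : (n < (n + n).+1)%N))) //=.
rewrite addnK big1 ?addr0 // => i /eqP ni.
have {}ni : i != n :> nat by apply: contra_not_neq ni => ni; apply: val_inj.
have [ltni|] := ltnP n i; first by rewrite nth_default ?mul0r // (leq_trans sP).
rewrite leq_eqVlt (negPf ni) /= => ltin.
by rewrite mulrC nth_default ?mul0r // (leq_trans sP) //; lia.
Qed.

(* By anisotropy, the leading terms of the three squares cannot cancel. *)
Lemma size_form (X Y Z : {poly L}) n :
  X \is a polyOver F -> Y \is a polyOver F -> Z \is a polyOver F ->
  (size X <= n.+1)%N -> (size Y <= n.+1)%N -> (size Z <= n.+1)%N ->
  (size (form X Y Z) <= n + n)%N ->
  [/\ (size X <= n)%N, (size Y <= n)%N & (size Z <= n)%N].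
Proof.
move=> XF YF ZF sX sY sZ /leq_sizeP/(_ _ (leqnn _)).
rewrite !coefB !coefCM !coef_sqr_top // => /eqP; rewrite subr_eq0 subr_eq => /eqP top.
have [Xn Yn Zn] : [/\ X`_n = 0, Y`_n = 0 & Z`_n = 0].
  by apply: aniso; rewrite ?polyOver_coef // addrC.
by split; apply/leq_sizeP => i; rewrite leq_eqVlt => /orP[/eqP <- //|ni];
  rewrite nth_default // (leq_trans _ ni).
Qed.

Lemma size_form_leq (X Y Z : {poly L}) n :
  (size X <= n.+1)%N -> (size Y <= n.+1)%N -> (size Z <= n.+1)%N ->
  (size (form X Y Z) <= (n + n).+1)%N.
Proof.
move=> sX sY sZ.
have sqr (P : {poly L}) : (size P <= n.+1)%N -> (size (P ^+ 2)%R <= (n + n).+1)%N.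
  by move=> sP; rewrite expr2 (leq_trans (size_polyMleq _ _)) //; lia.
have sqrC (c : L) (P : {poly L}) : (size P <= n.+1)%N -> (size (c%:P * P ^+ 2)%R <= (n + n).+1)%N.
  by move=> sP; rewrite mul_polyC (leq_trans (size_scale_leq _ _)) ?sqr.
by do 2!rewrite (leq_trans (size_polyD _ _)) // geq_max size_polyN ?sqr ?sqrC ?andbT //.
Qed.

Lemma linear_poly_root (P : {poly L}) : P \is a polyOver F -> size P = 2%N ->
  exists2 r, r \in F & root P r.
Proof.
move=> PF sP; exists (- P`_0 / P`_1); first by rewrite rpredM ?rpredN ?rpredV ?polyOver_coef.
have P1 : P`_1 != 0 by have := lead_coef_eq0 P; rewrite lead_coefE -size_poly_eq0 sP /= => ->.
rewrite /root horner_coef sP big_ord_recl big_ord1 /= expr0 expr1 mulr1.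
by rewrite mulrC divfK // addrN.
Qed.

(** Lift a zero to polynomials of degree at most 2; the form at these has degree at most 4 and is
    divisible by the cubic minimal polynomial of [t]. If its degree is at most 3, [size_form] makes
    the lifts linear, and [form0] kills them. Otherwise the quotient is linear with a root r in F;
    by anisotropy over F the lifts vanish at r, and dividing them by X - r makes them linear
    again. *)
Lemma springer_cubic : adjoin_degree F t = 3%N -> anisotropic_on (mem <<F; t>>%VS) a b.
Proof.
move=> deg3 x y z xK yK zK xyz.
pose X := Fadjoin_poly F t x; pose Y := Fadjoin_poly F t y; pose Z := Fadjoin_poly F t z.
have [XF YF ZF] : [/\ X \is a polyOver F, Y \is a polyOver F & Z \is a polyOver F].
  by rewrite !Fadjoin_polyOver.
have [sX sY sZ] : [/\ size X <= 3, size Y <= 3 & size Z <= 3]%N.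
  by rewrite -deg3 !size_Fadjoin_poly.
have formF U V W : U \is a polyOver F -> V \is a polyOver F -> W \is a polyOver F ->
  form U V W \is a polyOver F.
  by move=> UF VF WF; rewrite /form !rpredB ?rpredM ?rpredX ?polyOverC.
have formt u U V W :
    (form U V W).[u] = W.[u] ^+ 2 - a * U.[u] ^+ 2 - b * V.[u] ^+ 2.
  by rewrite /form !(hornerE, horner_exp).
(* For linear lifts the form has degree at most 2, so it is zero once it vanishes at [t]; two rounds
   of comparing leading terms then kill the lifts. *)
have form0 U V W : U \is a polyOver F -> V \is a polyOver F -> W \is a polyOver F ->
    (size U <= 2)%N -> (size V <= 2)%N -> (size W <= 2)%N ->
    root (form U V W) t -> [/\ U = 0, V = 0 & W = 0].
  move=> UF VF WF sU sV sW.
  rewrite (root_small_adjoin_poly (K := F)) ?formF ?deg3 ?(size_form_leq (n := 1)) // => /eqP f0.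
  have [] := @size_form U V W 1; rewrite ?f0 ?size_poly0 // => sU1 sV1 sW1.
  have [] := @size_form U V W 0; rewrite ?f0 ?size_poly0 // !leqn0 !size_poly_eq0.
  by do 3!move/eqP->.
suff [X0 Y0 Z0] : [/\ X = 0, Y = 0 & Z = 0].
  rewrite -(Fadjoin_poly_eq xK) -(Fadjoin_poly_eq yK) -(Fadjoin_poly_eq zK).
  by rewrite -/X -/Y -/Z X0 Y0 Z0 horner0.
have Gt : root (form X Y Z) t.
  by rewrite /root formt !Fadjoin_poly_eq // xyz; apply/eqP; ring.
have [sG|sG] := leqP (size (form X Y Z)) 4.
  have [] := @size_form X Y Z 2 => // sX2 sY2 sZ2; exact: form0.
have mF := minPolyOver F t; have sm := size_minPoly F t; rewrite deg3 in sm.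
have /divpK := minPoly_dvdp (formF _ _ _ XF YF ZF) Gt.
set Q := _ %/ _ => QE.
have QF : Q \is a polyOver F by rewrite divp_polyOver ?formF.
have sQ : size Q = 2%N.
  have Q0 : Q != 0 by apply: contraTneq sG => Q0; rewrite -QE Q0 mul0r size_poly0.
  have sE : size (form X Y Z) = (size Q).+3.
    by rewrite -QE size_Mmonic ?monic_minPoly // sm addnS !addnS addn0.
  have := size_form_leq (n := 2) sX sY sZ; rewrite sE in sG *.
  by case: (size Q) sG => [|[|[|k]]].
have [r rF /rootP Qr] := linear_poly_root QF sQ.
have tr : t - r != 0.
  rewrite subr_eq0; apply: contra_eq_neq deg3 => tr.
  by move: rF; rewrite -tr -adjoin_deg_eq1 => /eqP ->.
have [Xr Yr Zr] : [/\ X.[r] = 0, Y.[r] = 0 & Z.[r] = 0].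
  apply: aniso; rewrite ?rpred_horner //; apply/eqP; rewrite -subr_eq0 opprD addrA.
  by rewrite -formt -QE hornerM Qr mul0r.
have factor P : P.[r] = 0 -> P \is a polyOver F -> (size P <= 3)%N ->
    exists P1, [/\ P = P1 * ('X - r%:P), P1 \is a polyOver F & (size P1 <= 2)%N].
  move=> Pr PF sP; exists (P %/ ('X - r%:P)); split.
  - by rewrite divpK // dvdp_XsubCl; apply/rootP.
  - by rewrite divp_polyOver // polyOverXsubC.
  by rewrite size_divp ?polyXsubC_eq0 // size_XsubC leq_subLR.
have [X1 [XE X1F sX1]] := factor X Xr XF sX.
have [Y1 [YE Y1F sY1]] := factor Y Yr YF sY.
have [Z1 [ZE Z1F sZ1]] := factor Z Zr ZF sZ.
have [||||||| X10 Y10 Z10] := form0 X1 Y1 Z1 => //; last first.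
  by rewrite XE YE ZE X10 Y10 Z10 mul0r.
rewrite /root formt -(mulIr_eq0 _ (mulIf tr)) -(mulIr_eq0 _ (mulIf tr)).
move: Gt; rewrite /root formt XE YE ZE !hornerM !hornerXsubC => /eqP <-.
by apply/eqP; ring.
Qed.
End Springer.

(** The degree of [t] over F is 1 or 3. Were it 2, the cofactor of the minimal polynomial in X^3 - c
    would have a root r in F; then t / r is a power of [eps], which puts [t] in F. *)
Lemma cube_root_anisotropic (F0 : fieldType) (L : fieldExtType F0) (F : {subfield L})
    (a b c eps t : L) :
  a \in F -> b \in F -> c \in F -> c != 0 -> eps \in F -> 3.-primitive_root eps ->
  t ^+ 3 = c -> anisotropic_on (mem F) a b -> anisotropic_on (mem <<F; t>>%VS) a b.
Proof.
move=> aF bF cF c0 epsF eps3 tc aniso.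
have [tF|tF] := boolP (t \in F).
  by rewrite (Fadjoin_idP tF).
have cubeF : 'X^3 - c%:P \is a polyOver F by rewrite rpredB ?rpredX ?polyOverX ?polyOverC.
have sc : size ('X^3 - c%:P) = 4%N by rewrite size_XnsubC.
have mF := minPolyOver F t; have sm := size_minPoly F t.
have : minPoly F t %| 'X^3 - c%:P.
  by apply: minPoly_dvdp => //; rewrite /root !hornerE ?hornerXn tc subrr.
have tdeg : adjoin_degree F t != 1%N by rewrite adjoin_deg_eq1.
move=> /[dup] /dvdp_leq; rewrite -size_poly_eq0 sc => /(_ isT) m4 /divpK.
set Q := _ %/ _ => QE.
have QF : Q \is a polyOver F by rewrite divp_polyOver.
have sQ : (size Q + adjoin_degree F t = 4)%N.
  have Q0 : Q != 0 by apply: contra_eq_neq sc => Q0; rewrite -QE Q0 mul0r size_poly0.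
  by rewrite -sc -QE size_Mmonic ?monic_minPoly // sm addnS.
have d0 : adjoin_degree F t != 0%N.
  by [].
have [d3|d3] := eqVneq (adjoin_degree F t) 3%N; first exact: springer_cubic.
have sQ2 : size Q = 2%N.
  move: m4; rewrite sm; move: (adjoin_degree F t) (size Q) sQ tdeg d0 d3.
  by clear=> d n; lia.
have [r rF Qr] := linear_poly_root QF sQ2.
have rc : r ^+ 3 = c.
  apply/eqP; rewrite -subr_eq0; have /rootP : root ('X^3 - c%:P) r.
    by rewrite -QE rootM Qr.
  by rewrite !hornerE ?hornerXn => ->.
have r0 : r != 0 by apply: contra_neq c0 => r0; rewrite -rc r0 expr0n.
have [i tE] : {i : 'I_3 | t / r = eps ^+ i}.
  by apply: prim_rootP => //; rewrite expr_div_n tc rc divff.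
by case/negP: tF; rewrite -(divfK r0 t) tE rpredM ?rpredX.
Qed.

(** * Quadratic reciprocity for primes congruent to 3 modulo 4 *)

(** Translation by 1 permutes F and adds #|F| to the sum of all elements, so #|F| is 0 in F; if 2
    were 0 too, an odd #|F| would give 1 = 0. *)
Lemma finField_2_neq0 (F : finFieldType) : odd #|F| -> 2%:R != 0 :> F.
Proof.
move=> oF; apply/negP => F2; have /eqP[] := oner_neq0 F.
have : (#|F|%:R : F) = 0.
  have : \sum_(x : F) x = \sum_(x : F) x + #|F|%:R.
    by rewrite -sumr_const -big_split [LHS](reindex_inj (addIr 1)).
  by rewrite -[LHS]addr0 => /addrI.
rewrite -(odd_double_half #|F|) oF natrD -mul2n natrM.
by rewrite (eqP F2) mul0r addr0.
Qed.

(** Write #|F| = 4k + 3. Since x^(2k+1) = 1 or -1 for nonzero x, the square of x^(k+1) is x or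
    -x. *)
Lemma finField_sqr_or_opp (F : finFieldType) (x : F) :
  #|F| = 3 %[mod 4] -> exists y, y ^+ 2 = x \/ y ^+ 2 = - x.
Proof.
move=> F4; have [->|x0] := eqVneq x 0; first by exists 0; left; rewrite expr0n.
have [k Fk] : exists k, #|F| = (4 * k + 3)%N by exists (#|F| %/ 4)%N; lia.
have xF : x ^+ (2 * k + 1) ^+ 2 = 1.
  apply: (mulfI x0); rewrite mulr1 -[RHS]expf_card Fk -exprM -exprS.
  by congr (_ ^+ _); lia.
exists (x ^+ k.+1); rewrite -exprM.
have -> : (k.+1 * 2 = (2 * k + 1).+1)%N by lia.
rewrite exprS; move/eqP: xF; rewrite sqrf_eq1 => /orP[] /eqP ->.
  by left; rewrite mulr1.
by right; rewrite mulrN1.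
Qed.

(** A square root of -1 would give 1 = x^(4k+2) = (-1)^(2k+1) = -1. *)
Lemma finField_opp1_nonsqr (F : finFieldType) (x : F) :
  #|F| = 3 %[mod 4] -> x ^+ 2 != -1.
Proof.
move=> F4; apply/eqP => x2.
have F2 : 2%:R != 0 :> F by apply: finField_2_neq0; lia.
have x0 : x != 0 by apply: contra_eq_neq x2 => ->; rewrite expr0n eq_sym oppr_eq0 oner_eq0.
have [k Fk] : exists k, #|F| = (4 * k + 3)%N by exists (#|F| %/ 4)%N; lia.
have xF : x ^+ 2 ^+ (2 * k + 1) = 1.
  apply: (mulfI x0); rewrite mulr1 -[RHS]expf_card Fk -exprM -exprS.
  by congr (_ ^+ _); lia.
move: xF; rewrite x2 exprD exprM sqrrN expr1n expr1n mul1r expr1 => /eqP.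
by rewrite -subr_eq0 -opprD oppr_eq0 (negPf F2).
Qed.

Section GaussSum.

Variables (p : nat) (E : fieldType) (z : E).
Hypotheses (p_pr : prime p) (p4 : p = 3 %[mod 4]).
Hypotheses (zp : z ^+ p = 1) (z1 : z != 1) (E2 : 2%:R != 0 :> E).

Let chi (x : 'F_p) : E :=
  if x == 0 then 0 else if [exists y, y ^+ 2 == x] then 1 else -1.

Let e (x : 'F_p) : E := z ^+ x.

Definition gauss_sum := \sum_x chi x * e x.

Let F4 : #|'F_p| = 3 %[mod 4].
Proof. by rewrite card_Fp. Qed.

Let chiM x y : chi (x * y) = chi x * chi y.
Proof.
rewrite /chi mulf_eq0.
have [_|x0] := eqVneq x 0; first by rewrite mul0r.
have [_|y0] := eqVneq y 0; first by rewrite mulr0.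
case: existsP => [[u /eqP xyE]|xyN]; case: existsP => [[v /eqP xE]|xN];
  case: existsP => [[w /eqP yE]|yN]; rewrite ?mulr1 ?mul1r ?mulN1r ?opprK //.
- by case: yN; exists (u / v); rewrite expr_div_n xyE xE mulrC mulKf.
- by case: xN; exists (u / w); rewrite expr_div_n xyE yE mulfK.
- by case: xyN; exists (v * w); rewrite exprMn xE yE.
(* Two nonsquares are both opposites of squares, so their product is a square. *)
- have [v [xE|xE]] := finField_sqr_or_opp x F4.
    by case: xN; exists v; apply/eqP.
  have [w [yE|yE]] := finField_sqr_or_opp y F4.
    by case: yN; exists w; apply/eqP.
  by case: xyN; exists (v * w); rewrite exprMn xE yE mulrNN.
Qed.

Let chiN1 : chi (-1) = -1.
Proof.
rewrite /chi oppr_eq0 oner_eq0; case: existsP => // -[x].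
by rewrite (negPf (finField_opp1_nonsqr x F4)).
Qed.

Let chi_sqr x : x != 0 -> chi x ^+ 2 = 1.
Proof.
by rewrite /chi => /negPf ->; case: ifP => _; rewrite ?sqrrN expr1n.
Qed.

Let e_nat n : e n%:R = z ^+ n.
Proof. by rewrite /e val_Fp_nat // expr_mod. Qed.

Let eD x y : e (x + y) = e x * e y.
Proof.
by rewrite -[x]natr_Zp -[y]natr_Zp -natrD !e_nat exprD.
Qed.

Let eM_nat x n : e (x * n%:R) = e x ^+ n.
Proof.
by rewrite -[x]natr_Zp -natrM !e_nat exprM.
Qed.

Let sum_chi : \sum_x chi x = 0.
Proof.
have : \sum_x chi x = - \sum_x chi x.
  rewrite [LHS](reindex_inj (@oppr_inj _)) -sumrN.
  by apply: eq_bigr => x _; rewrite -mulN1r chiM chiN1 mulN1r.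
move/eqP; rewrite -addr_eq0 -mulr2n -mulr_natl mulf_eq0 (negPf E2) /=.
by move/eqP.
Qed.

Let sum_e c : \sum_x e (x * c) = if c == 0 then p%:R else 0.
Proof.
case: eqVneq => [->|c0].
  under eq_bigr do rewrite mulr0 /e expr0.
  by rewrite sumr_const card_Fp.
have : \sum_x e (x * c) = \sum_x e (x * c) * z.
  rewrite [LHS](reindex_inj (addIr c^-1)).
  by apply: eq_bigr => x _; rewrite mulrDl mulVf // eD -(expr1 z) -e_nat.
rewrite -mulr_suml => /eqP; rewrite -subr_eq0 -{1}[X in X - _]mulr1 -mulrBr.
by rewrite mulf_eq0 subr_eq0 [1 == _]eq_sym (negPf z1) orbF => /eqP.
Qed.

(** Expand the square and substitute y = x t. As chi(x)^2 = 1, the sum over nonzero x of e(x(1 + t))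
    remains: it is p - 1 for t = -1 and -1 otherwise. Since chi sums to 0, the total is p chi(-1) =
    -p. *)
Lemma gauss_sum_sqr : gauss_sum ^+ 2 = - p%:R.
Proof.
have step x : chi x * e x * gauss_sum =
    \sum_t chi t * (if x == 0 then 0 else e (x * (1 + t))).
  have [->|x0] := eqVneq x 0.
    by rewrite {1}/chi eqxx !mul0r big1 // => t _; rewrite mulr0.
  rewrite /gauss_sum (reindex_inj (mulfI x0)) mulr_sumr.
  apply: eq_bigr => t _; rewrite chiM mulrDr mulr1 eD.
  have -> : chi x * e x * (chi x * chi t * e (x * t)) =
    chi x ^+ 2 * (chi t * (e x * e (x * t))) by ring.
  by rewrite chi_sqr // mul1r.
rewrite expr2 {1}/gauss_sum mulr_suml (eq_bigr _ (fun x _ => step x)).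
rewrite exchange_big /=.
have inner t : \sum_x chi t * (if x == 0 then 0 else e (x * (1 + t))) =
    chi t * (if t == -1 then p%:R else 0) - chi t.
  transitivity (chi t * ((if t == -1 then p%:R else 0) - 1)); last first.
    by rewrite mulrBr mulr1.
  rewrite -mulr_sumr; congr (_ * _).
  rewrite -addr_eq0 [t + 1]addrC -sum_e.
  rewrite [in RHS](bigD1 0) //= [in LHS](bigD1 0) //= add0r mul0r.
  rewrite {2}/e expr0 addrAC subrr add0r.
  by apply: eq_bigr => x /negPf ->.
rewrite (eq_bigr _ (fun t _ => inner t)) sumrB sum_chi subr0.
rewrite (bigD1 (-1)) //= eqxx chiN1 big1 ?addr0 ?mulN1r //.
by move=> t /negPf ->; rewrite mulr0.
Qed.

(** The q-th power is additive and fixes the values of chi, while it sends e(x) to e(q x);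
    reindexing by x q brings out chi(q) = -1. *)
Lemma gauss_sum_Frobenius (q : nat) :
  q \in [pchar E] -> odd q -> q%:R != 0 :> 'F_p ->
  (forall y : 'F_p, y ^+ 2 != q%:R) -> gauss_sum ^+ q = - gauss_sum.
Proof.
move=> charE oq q0 qN.
have chiq : chi q%:R = -1.
  by rewrite /chi (negPf q0); case: existsP => // -[y]; rewrite (negPf (qN y)).
have chiX x : chi x ^+ q = chi x.
  rewrite /chi; case: ifP => _; first by rewrite expr0n; case: q oq {charE q0 qN chiq}.
  by case: ifP => _; rewrite ?expr1n // -signr_odd oq.
rewrite -(pFrobenius_autE charE) raddf_sum /= /gauss_sum.
rewrite [in RHS](reindex_inj (mulIf q0)) -sumrN; apply: eq_bigr => x _.
by rewrite pFrobenius_autE exprMn chiX chiM chiq eM_nat; ring.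
Qed.

End GaussSum.

(** In an algebraic closure of ['F_q] the Gauss sum g satisfies g^2 = -p and g^q = -g. If p were not
    a square modulo q, then -p would be one, so g would lie in ['F_q] and g^q = g, forcing g = 0. *)
Lemma sqr_reciprocity (p q : nat) :
  prime p -> prime q -> p = 3 %[mod 4] -> q = 3 %[mod 4] -> p != q ->
  (forall y : 'F_p, y ^+ 2 != q%:R) -> exists y : 'F_q, y ^+ 2 = p%:R.
Proof.
move=> p_pr q_pr p4 q4 npq qN.
have [K [iota _]] := countable_algebraic_closure 'F_q.
have charK : q \in [pchar K] by rewrite (fmorph_pchar iota) pchar_Fp.
have p0 : p%:R != 0 :> K.
  by rewrite -(dvdn_pcharf charK) dvdn_prime2 // eq_sym.
have q0 : q%:R != 0 :> 'F_p.
  by rewrite -(dvdn_pcharf (pchar_Fp p_pr)) dvdn_prime2.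
have K2 : 2%:R != 0 :> K.
  by rewrite -(dvdn_pcharf charK) dvdn_prime2 //; apply/eqP => q2; rewrite q2 in q4.
have oq : odd q by lia.
(* A root of 1 + X + ... + X^(p-1) is a p-th root of unity, and it is not 1 because P(1) = p is
   nonzero in K. *)
pose P : {poly K} := \poly_(i < p) 1.
have sP : size P != 1%N.
  by rewrite size_poly_eq ?oner_neq0 //; apply: contraTneq p_pr => ->.
have /closed_rootP[z /rootP Pz] := sP.
have zp : z ^+ p = 1.
  apply/eqP; rewrite -subr_eq0 subrX1.
  by move: Pz; rewrite horner_poly; under eq_bigr do rewrite mul1r; move=> ->; rewrite mulr0.
have z1 : z != 1.
  apply: contra_neq p0 => z1; rewrite -[RHS]Pz horner_poly z1.
  by under eq_bigr do rewrite mul1r expr1n; rewrite sumr_const card_ord.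
pose g := gauss_sum p z.
have g2 : g ^+ 2 = - p%:R by exact: gauss_sum_sqr.
have gq : g ^+ q = - g by exact: gauss_sum_Frobenius.
have g0 : g != 0.
  by apply: contra_eq_neq g2 => ->; rewrite expr0n eq_sym oppr_eq0.
have [y [yE|yE]] : exists y : 'F_q, y ^+ 2 = p%:R \/ y ^+ 2 = - p%:R.
    by apply: finField_sqr_or_opp; rewrite card_Fp.
  by exists y.
have yq : iota y ^+ q = iota y.
  by rewrite -rmorphXn -[in X in _ ^+ X](card_Fp q_pr) expf_card.
have : g ^+ q = g.
  have /eqP : g ^+ 2 = iota y ^+ 2 by rewrite g2 -rmorphXn yE rmorphN rmorph_nat.
  by rewrite eqf_sqr => /orP[] /eqP -> //; rewrite exprNn -signr_odd oq yq mulN1r.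
rewrite gq => gN; have /eqP : 2%:R * g = 0 by rewrite mulr_natl mulr2n -{1}gN addNr.
by rewrite mulf_eq0 (negPf K2) (negPf g0).
Qed.

(** * Small solutions by the pigeonhole principle *)

(* For [f] additive, two points of a box with the same image differ by a kernel vector. *)
Lemma small_kernel_vector (T : finType) (f : int * int * int -> T) (A B C : nat) :
  (#|T| < A.+1 * B.+1 * C.+1)%N ->
  (forall u v, f u = f v -> f (u - v) = f 0) ->
  exists2 w : int * int * int, w != 0 & f w = f 0 /\
    [/\ (`|w.1.1| <= A)%N, (`|w.1.2| <= B)%N & (`|w.2| <= C)%N].
Proof.
move=> ltT fB.
pose g (i : 'I_A.+1 * 'I_B.+1 * 'I_C.+1) : int * int * int :=
  (i.1.1%:Z, i.1.2%:Z, i.2%:Z).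
have /injectivePn[i [j nij fij]] : ~~ injectiveb (f \o g).
  apply/injectiveP => /leq_card; rewrite !card_prod !card_ord leqNgt.
  by rewrite ltT.
exists (g i - g j); last first.
  split; first exact: fB.
  case: i j {nij fij} => [[i1 i2] i3] [[j1 j2] j3] /=.
  move: (ltn_ord i1) (ltn_ord i2) (ltn_ord i3).
  move: (ltn_ord j1) (ltn_ord j2) (ltn_ord j3).
  by split; [change (`|i1%:Z - j1%:Z| <= A)%N | change (`|i2%:Z - j2%:Z| <= B)%N
    | change (`|i3%:Z - j3%:Z| <= C)%N]; lia.
apply: contra_neq nij => /subr0_eq.
case: i j {fij} => [[i1 i2] i3] [[j1 j2] j3] [e1 e2 e3].
by congr (_, _, _); apply: val_inj.
Qed.

Lemma nat_sqrt (n : nat) : exists a, (a * a <= n < a.+1 * a.+1)%N.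
Proof.
have exP : exists a, (a * a <= n)%N by exists 0%N.
have ubP a : (a * a <= n)%N -> (a <= n)%N by nia.
case: (ex_maxnP exP ubP) => a an amax; exists a; rewrite an /= ltnNge.
by apply/negP => /amax; rewrite ltnn.
Qed.

Lemma prime_nonsqr (p a : nat) : prime p -> (a * a)%N <> p.
Proof.
move=> /primeP[p1 pP] pE; have /pP : (a %| p)%N by rewrite -pE dvdn_mulr.
by clear -pE p1; nia.
Qed.

Lemma Fp_intr_eq0 (p : nat) (m : int) :
  prime p -> (m%:~R == 0 :> 'F_p) = (p%:Z %| m)%Z.
Proof.
move=> p_pr; rewrite dvdzE /= (dvdn_pcharf (pchar_Fp p_pr)).
by case: m => m //; rewrite NegzE mulrNz oppr_eq0.
Qed.

Lemma dvdz_Fp (p : nat) (m n : int) :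
  prime p -> (m - n)%:~R = 0 :> 'F_p -> exists k, m = n + k * p%:Z.
Proof.
move=> p_pr /eqP; rewrite Fp_intr_eq0 // => /dvdzP[k kE].
by exists k; rewrite -kE; ring.
Qed.

(** For nonzero [e] the 3-adic valuations of the two sides have different parities. *)
Lemma sqr_eq_3sqr_eq0 (a e : int) : a ^+ 2 = 3 * e ^+ 2 -> e = 0.
Proof.
move=> aE; apply/eqP; apply/negPn/negP => e0.
have a0 : a != 0 by apply: contra_neq e0 => a0; nia.
have : (`|a| ^ 2 = 3 * `|e| ^ 2)%N by nia.
move=> /(congr1 (logn 3)); rewrite lognX lognM ?expn_gt0 ?absz_gt0 ?e0 //.
by rewrite lognX (_ : logn 3 3 = 1%N) //; lia.
Qed.

(** Thue's argument: some nonzero (a, e) with a = r e modulo p has both entries below sqrt p. Then p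
    divides a^2 - 3 e^2, which lies strictly between -3p and p and is not 0. *)
Lemma small_norm_sqrt3 (p : nat) (r : int) : prime p -> (p%:Z %| r ^+ 2 - 3)%Z ->
  exists a e : int, a ^+ 2 - 3 * e ^+ 2 = - p%:Z \/ a ^+ 2 - 3 * e ^+ 2 = - (2 * p%:Z).
Proof.
move=> p_pr /dvdzP[k kE]; have [A /andP[A1 A2]] := nat_sqrt p.
pose f (w : int * int * int) : 'F_p := (w.1.1 - r * w.1.2)%:~R.
(* The third coordinate is confined to 0, which leaves a box of (A + 1)^2 > p pairs. *)
have [|u v fuv|[[a e] z] w0 [fw [/= aA eA zA]]] := @small_kernel_vector _ f A A 0.
- by rewrite card_Fp // muln1.
- transitivity (f u - f v); last by rewrite fuv subrr /f mulr0 subr0.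
  by rewrite /f -rmorphB /=; congr _%:~R; ring.
have {w0} ae0 : a != 0 \/ e != 0.
  have z0 : z = 0 by lia.
  apply/orP; rewrite -negb_and; apply: contra w0 => /andP[/eqP-> /eqP->].
  by rewrite z0.
have [|l aE] := @dvdz_Fp p a (r * e) p_pr; first by rewrite -[LHS]/(f (a, e, z)) fw /f mulr0 subr0.
pose m := k * e ^+ 2 + l * (2 * r * e + l * p%:Z).
have nE : a ^+ 2 - 3 * e ^+ 2 = m * p%:Z.
  transitivity ((r ^+ 2 - 3) * e ^+ 2 + l * p%:Z * (2 * r * e + l * p%:Z)).
    by rewrite aE; ring.
  by rewrite kE /m; ring.
have pA := @prime_nonsqr p A p_pr.
have p0 := prime_gt0 p_pr.
have a2 : a ^+ 2 < p%:Z by clear -aA A1 pA; nia.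
have e2 : e ^+ 2 < p%:Z by clear -eA A1 pA; nia.
exists a, e; rewrite nE.
have m0 : m != 0.
  apply/eqP => m0; have /subr0_eq aE3 : a ^+ 2 - 3 * e ^+ 2 = 0 by rewrite nE m0 mul0r.
  have e0 := sqr_eq_3sqr_eq0 aE3; move: aE3 ae0; rewrite e0 expr0n mulr0 => /eqP.
  by rewrite sqrf_eq0 => /eqP ->; case.
have [m1 m3] : m < 1 /\ -3 < m.
  by clear -nE a2 e2 p0; split; nia.
have [->|->] : m = -1 \/ m = -2 by clear -m0 m1 m3; lia.
  by left; ring.
by right; ring.
Qed.

(** Pigeonhole in a box with sides sqrt q, sqrt p, sqrt (p q) gives a small nonzero vector with z =
    r y modulo p and z = t x modulo q. Then n = z^2 + q y^2 - p x^2 is a multiple of p q strictly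
    between -p q and 2 p q, hence 0 or p q. *)
Lemma legendre_two_primes (p q : nat) (r t : int) :
  prime p -> prime q -> p != q ->
  (p%:Z %| r ^+ 2 + q%:Z)%Z -> (q%:Z %| t ^+ 2 - p%:Z)%Z ->
  exists x y z : int, x != 0 /\ p%:Z * x ^+ 2 = z ^+ 2 + q%:Z * y ^+ 2.
Proof.
move=> p_pr q_pr npq /dvdzP[k kE] /dvdzP[h hE].
have [A /andP[A1 A2]] := nat_sqrt q.
have [B /andP[B1 B2]] := nat_sqrt p.
have [C /andP[C1 C2]] := nat_sqrt (p * q).
pose f (w : int * int * int) : 'F_p * 'F_q :=
  ((w.2 - r * w.1.2)%:~R, (w.2 - t * w.1.1)%:~R).
have fB (u v : int * int * int) : f (u - v) = f u - f v.
  apply: injective_projections.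
    by rewrite [RHS](_ : _ = (f u).1 - (f v).1) // /f /= -intrB; congr _%:~R; ring.
  by rewrite [RHS](_ : _ = (f u).2 - (f v).2) // /f /= -intrB; congr _%:~R; ring.
have f0 : f 0 = 0 by rewrite -[0]subr0 fB subrr.
have [|u v fuv|[[x y] z] w0 [fw [/= xA yB zC]]] :=
    @small_kernel_vector _ f A B C.
(* The sides are compared after squaring, since (p q)^2 = q * p * (p q). *)
- rewrite card_prod !card_Fp // -(ltn_sqr (p * q)%N) !expnMn -!mulnn.
  rewrite [X in (X < _)%N](_ : _ = q * p * (p * q))%N; last by ring.
  by apply: ltn_mul => //; apply: ltn_mul.
- by rewrite fB fuv subrr f0.
have [/(dvdz_Fp p_pr)[l lE] /(dvdz_Fp q_pr)[m mE]] :
    (z - r * y)%:~R = 0 :> 'F_p /\ (z - t * x)%:~R = 0 :> 'F_q.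
  by move: fw; rewrite f0 => -[].
pose n := z ^+ 2 + q%:Z * y ^+ 2 - p%:Z * x ^+ 2.
have /dvdzP[j jE] : (p%:Z * q%:Z %| n)%Z.
  rewrite Gauss_dvdz; last by rewrite coprimezE /= prime_coprime // dvdn_prime2.
  apply/andP; split; apply/dvdzP.
    exists (k * y ^+ 2 + l * (2 * r * y + l * p%:Z) - x ^+ 2).
    transitivity ((r ^+ 2 + q%:Z) * y ^+ 2 + l * p%:Z * (2 * r * y + l * p%:Z)
      - p%:Z * x ^+ 2); first by rewrite /n lE; ring.
    by rewrite kE; ring.
  exists (h * x ^+ 2 + m * (2 * t * x + m * q%:Z) + y ^+ 2).
  transitivity ((t ^+ 2 - p%:Z) * x ^+ 2 + m * q%:Z * (2 * t * x + m * q%:Z)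
    + q%:Z * y ^+ 2); first by rewrite /n mE; ring.
  by rewrite hE; ring.
have [p0 q0] := (prime_gt0 p_pr, prime_gt0 q_pr).
have x2 : x ^+ 2 < q%:Z by have := @prime_nonsqr q A q_pr; clear -xA A1; nia.
have y2 : y ^+ 2 < p%:Z by have := @prime_nonsqr p B p_pr; clear -yB B1; nia.
have z2 : z ^+ 2 <= p%:Z * q%:Z by clear -zC C1; nia.
have jlt : -1 < j < 2.
  have nlt : n < 2 * (p%:Z * q%:Z) by rewrite /n; clear -p0 q0 x2 y2 z2; nia.
  have ngt : n > - (p%:Z * q%:Z) by rewrite /n; clear -p0 q0 x2 y2 z2; nia.
  by clear -nlt ngt jE p0 q0; rewrite jE in nlt ngt; apply/andP; split; nia.
have [j0|j1] : j = 0 \/ j = 1 by clear -jlt; lia.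
  exists x, y, z; split; last by apply/eqP; rewrite -subr_eq0 -oppr_eq0 opprB -/n jE j0 mul0r.
  apply: contra w0 => /eqP x0; move: jE; rewrite j0 mul0r /n x0.
  clear -q0 => nE; have [-> ->] : y = 0 /\ z = 0 by split; nia.
  by [].
(* z^2 + q y^2 = p (x^2 + q), and x^2 + q is a norm from Q(sqrt(-q)). *)
exists (x ^+ 2 + q%:Z), (z + x * y), (z * x - q%:Z * y); split.
  by clear -q0; nia.
transitivity ((z ^+ 2 + q%:Z * y ^+ 2) * (x ^+ 2 + q%:Z)); last by ring.
have -> : z ^+ 2 + q%:Z * y ^+ 2 = p%:Z * (x ^+ 2 + q%:Z).
  by rewrite mulrDr -[p%:Z * q%:Z]mul1r -j1 -jE /n; ring.
by ring.
Qed.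

(** * Descent in Z[sqrt(-3)] *)

Lemma dvdz_sqr_prime (p : nat) (m : int) : prime p -> (p%:Z %| m ^+ 2)%Z = (p%:Z %| m)%Z.
Proof. by move=> p_pr; rewrite !dvdzE abszX Euclid_dvdX // andbT. Qed.

(* If p^2 divides t^2 + 3, it does not divide (t + p)^2 + 3. *)
Lemma sqrt_opp3_mod_p (p : nat) (t : int) : prime p -> odd p -> p != 3%N ->
  (p%:Z %| t ^+ 2 + 3)%Z ->
  exists s m : int, s ^+ 2 + 3 = p%:Z * m /\ ~~ (p%:Z %| m)%Z.
Proof.
move=> p_pr op p3 /dvdzP[k kE].
have p0 : p%:Z != 0 by have := prime_gt0 p_pr; lia.
have [/dvdzP[l lE]|kN] := boolP (p%:Z %| k)%Z; last first.
  by exists t, k; rewrite kE mulrC.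
exists (t + p%:Z), (k + 2 * t + p%:Z); split.
  transitivity (t ^+ 2 + 3 + p%:Z * (2 * t + p%:Z)); first by ring.
  by rewrite kE; ring.
apply/negP; rewrite lE -addrA addrC -addrA => pt.
have {pt} : (p%:Z %| 2 * t)%Z.
  move: pt => /dvdzP[j jE]; apply/dvdzP; exists (j - 1 - l).
  by rewrite -[LHS](addrK (p%:Z + l * p%:Z)) jE; ring.
have copr2 : coprimez p%:Z 2 by rewrite coprimezE /= coprimen2.
rewrite (Gauss_dvdzr _ copr2) => /dvdzP[j jE].
have : (p%:Z %| 3)%Z.
  apply/dvdzP; exists (k - j ^+ 2 * p%:Z).
  by rewrite -[LHS](addKr (t ^+ 2)) kE jE; ring.
by rewrite dvdzE /= dvdn_prime2 // (negPf p3).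
Qed.

Section Descent.
Variables (p : nat) (q s m : int).
Hypotheses (p_pr : prime p) (op : odd p).
Hypotheses (sm : s ^+ 2 + 3 = p%:Z * m) (pm : ~~ (p%:Z %| m)%Z).
Hypotheses (ps : ~~ (p%:Z %| s)%Z).
Hypothesis qN : forall y : 'F_p, y ^+ 2 != q%:~R.

(* The components of z^2 = p x^2 + q y^2 in Z[sqrt(-3)], the second one halved. *)
Let sol (x0 x1 y0 y1 z0 z1 : int) :=
  z0 ^+ 2 - 3 * z1 ^+ 2 = p%:Z * (x0 ^+ 2 - 3 * x1 ^+ 2) + q * (y0 ^+ 2 - 3 * y1 ^+ 2)
  /\ z0 * z1 = p%:Z * (x0 * x1) + q * (y0 * y1).

Let p0 : p%:Z != 0.
Proof. by have := prime_gt0 p_pr; lia. Qed.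

(* a' + b' sqrt(-3) = (a + b sqrt(-3)) (s + sqrt(-3)) / p, where s + sqrt(-3) is
   the conjugate of a generator of the prime above p, up to factors prime to p. *)
Let divP (a b : int) : (p%:Z %| a + b * s)%Z ->
  exists a' b', [/\ a * s - 3 * b = a' * p%:Z, a + b * s = b' * p%:Z &
    m * (a ^+ 2 + 3 * b ^+ 2) = p%:Z * (a' ^+ 2 + 3 * b' ^+ 2)].
Proof.
move=> /dvdzP[b' bE]; exists (b' * s - b * m), b'.
have aE : a * s - 3 * b = (b' * s - b * m) * p%:Z.
  transitivity ((a + b * s) * s - b * (s ^+ 2 + 3)); first by ring.
  by rewrite bE sm; ring.
split=> //; apply: (mulfI p0).
transitivity ((s ^+ 2 + 3) * (a ^+ 2 + 3 * b ^+ 2)); first by rewrite sm; ring.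
transitivity ((a * s - 3 * b) ^+ 2 + 3 * (a + b * s) ^+ 2); first by ring.
by rewrite aE bE; ring.
Qed.

Let nonsqr_dvd (u v : int) :
  (p%:Z %| u ^+ 2 - q * v ^+ 2)%Z -> (p%:Z %| u)%Z /\ (p%:Z %| v)%Z.
Proof.
rewrite -!Fp_intr_eq0 // intrB intrM => uv0.
have {uv0} uv : (u%:~R : 'F_p) ^+ 2 - q%:~R * v%:~R ^+ 2 == 0 by rewrite -!rmorphXn.
have v0 : v%:~R = 0 :> 'F_p.
  apply/eqP/negPn/negP => v0; move: uv; rewrite subr_eq0 => /eqP uv.
  by have /eqP[] := qN (u%:~R / v%:~R); rewrite expr_div_n uv mulfK // sqrf_eq0.
by move: uv; rewrite v0 eqxx expr0n mulr0 subr0 sqrf_eq0.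
Qed.

(** Let P be the prime above p at which sqrt(-3) reduces to [s]. Modulo P the equation is z^2 = q
    y^2, so P divides y and z; then P^2 divides p x^2, and as P divides p only once, P divides x.
    Dividing all three by P multiplies their norms by m / p. *)
Lemma sqrt_opp3_descent_step x0 x1 y0 y1 z0 z1 : sol x0 x1 y0 y1 z0 z1 ->
  exists x0' x1' y0' y1' z0' z1', sol x0' x1' y0' y1' z0' z1' /\
  [/\ m * (x0 ^+ 2 + 3 * x1 ^+ 2) = p%:Z * (x0' ^+ 2 + 3 * x1' ^+ 2),
      m * (y0 ^+ 2 + 3 * y1 ^+ 2) = p%:Z * (y0' ^+ 2 + 3 * y1' ^+ 2) &
      m * (z0 ^+ 2 + 3 * z1 ^+ 2) = p%:Z * (z0' ^+ 2 + 3 * z1' ^+ 2)].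
Proof.
case=> e0 e1.
have [pz py] : (p%:Z %| z0 + z1 * s)%Z /\ (p%:Z %| y0 + y1 * s)%Z.
  apply: nonsqr_dvd; apply/dvdzP.
  exists ((x0 ^+ 2 - 3 * x1 ^+ 2) + 2 * s * (x0 * x1) + m * (z1 ^+ 2 - q * y1 ^+ 2)).
  transitivity ((z0 ^+ 2 - 3 * z1 ^+ 2) + 2 * s * (z0 * z1)
     - q * (y0 ^+ 2 - 3 * y1 ^+ 2 + 2 * s * (y0 * y1))
     + (s ^+ 2 + 3) * (z1 ^+ 2 - q * y1 ^+ 2)); first by ring.
  by rewrite e0 e1 sm; ring.
have [z0' [z1' [za zb zn]]] := divP pz.
have [y0' [y1' [ya yb yn]]] := divP py.
(* These are the components of (x (s + sqrt(-3)))^2 = p (z'^2 - q y'^2), the equation times (s +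
   sqrt(-3))^2 / p. *)
have key : (x0 * s - 3 * x1) ^+ 2 - 3 * (x0 + x1 * s) ^+ 2 =
    p%:Z * (z0' ^+ 2 - 3 * z1' ^+ 2 - q * (y0' ^+ 2 - 3 * y1' ^+ 2)) /\
    (x0 * s - 3 * x1) * (x0 + x1 * s) = p%:Z * (z0' * z1' - q * (y0' * y1')).
  split; apply: (mulfI p0).
    transitivity ((s ^+ 2 - 3) * (p%:Z * (x0 ^+ 2 - 3 * x1 ^+ 2))
      - 12 * s * (p%:Z * (x0 * x1))); first by ring.
    transitivity ((z0' * p%:Z) ^+ 2 - 3 * (z1' * p%:Z) ^+ 2
      - q * ((y0' * p%:Z) ^+ 2 - 3 * (y1' * p%:Z) ^+ 2)); last by ring.
    rewrite -za -zb -ya -yb.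
    transitivity ((s ^+ 2 - 3) * (z0 ^+ 2 - 3 * z1 ^+ 2 - q * (y0 ^+ 2 - 3 * y1 ^+ 2))
      - 12 * s * (z0 * z1 - q * (y0 * y1))); last by ring.
    by rewrite e0 e1; ring.
  transitivity (s * (p%:Z * (x0 ^+ 2 - 3 * x1 ^+ 2))
    + (s ^+ 2 - 3) * (p%:Z * (x0 * x1))); first by ring.
  transitivity ((z0' * p%:Z) * (z1' * p%:Z) - q * ((y0' * p%:Z) * (y1' * p%:Z))); last by ring.
  rewrite -za -zb -ya -yb.
  transitivity (s * (z0 ^+ 2 - 3 * z1 ^+ 2 - q * (y0 ^+ 2 - 3 * y1 ^+ 2))
    + (s ^+ 2 - 3) * (z0 * z1 - q * (y0 * y1))); last by ring.
  by rewrite e0 e1; ring.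
have px : (p%:Z %| x0 + x1 * s)%Z.
  have [k1 k2] := key.
  (* This is x (s + sqrt(-3)) reduced at P, where its square vanishes. It is congruent to 2 s (x0 +
     x1 s), and 2 s is prime to p. *)
  have /dvdzP[c cE] : (p%:Z %| x0 * s - 3 * x1 + (x0 + x1 * s) * s)%Z.
    rewrite -dvdz_sqr_prime //; apply/dvdzP.
    exists (z0' ^+ 2 - 3 * z1' ^+ 2 - q * (y0' ^+ 2 - 3 * y1' ^+ 2)
      + 2 * s * (z0' * z1' - q * (y0' * y1')) + m * (x0 + x1 * s) ^+ 2).
    transitivity ((x0 * s - 3 * x1) ^+ 2 - 3 * (x0 + x1 * s) ^+ 2
      + 2 * s * ((x0 * s - 3 * x1) * (x0 + x1 * s))
      + (s ^+ 2 + 3) * (x0 + x1 * s) ^+ 2); first by ring.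
    by rewrite k1 k2 sm; ring.
  have copr2 : coprimez p%:Z 2 by rewrite coprimezE /= coprimen2.
  have coprs : coprimez p%:Z s by rewrite coprimezE prime_coprime // -dvdzE.
  rewrite -(Gauss_dvdzr _ coprs) -(Gauss_dvdzr _ copr2); apply/dvdzP.
  exists (c + m * x1); rewrite [RHS]mulrDl -cE.
  transitivity (x0 * s - 3 * x1 + (x0 + x1 * s) * s + (s ^+ 2 + 3) * x1); first by ring.
  by rewrite sm; ring.
have [x0' [x1' [xa xb xn]]] := divP px.
exists x0', x1', y0', y1', z0', z1'; split; last by split.
have [k1 k2] := key; rewrite xa xb in k1 k2.
split; apply: (mulfI p0).
  transitivity (p%:Z * (z0' ^+ 2 - 3 * z1' ^+ 2 - q * (y0' ^+ 2 - 3 * y1' ^+ 2))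
    + p%:Z * (q * (y0' ^+ 2 - 3 * y1' ^+ 2))); first by ring.
  by rewrite -k1; ring.
transitivity (p%:Z * (z0' * z1' - q * (y0' * y1')) + p%:Z * (q * (y0' * y1'))); first by ring.
by rewrite -k2; ring.
Qed.

(** Since p does not divide [m], iterating the step shows that every power of p divides the three
    norms. *)
Lemma sqrt_opp3_descent x0 x1 y0 y1 z0 z1 : sol x0 x1 y0 y1 z0 z1 ->
  [/\ x0 ^+ 2 + 3 * x1 ^+ 2 = 0, y0 ^+ 2 + 3 * y1 ^+ 2 = 0 & z0 ^+ 2 + 3 * z1 ^+ 2 = 0].
Proof.
move=> xyz.
have pn n : forall x0 x1 y0 y1 z0 z1, sol x0 x1 y0 y1 z0 z1 ->
  [/\ (p%:Z ^+ n %| x0 ^+ 2 + 3 * x1 ^+ 2)%Z, (p%:Z ^+ n %| y0 ^+ 2 + 3 * y1 ^+ 2)%Z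
    & (p%:Z ^+ n %| z0 ^+ 2 + 3 * z1 ^+ 2)%Z].
  elim: n => [|n IHn] {xyz x0 x1 y0 y1 z0 z1} x0 x1 y0 y1 z0 z1 xyz.
    by rewrite expr0 !dvd1z.
  have [x0' [x1' [y0' [y1' [z0' [z1' [xyz' [xn yn zn]]]]]]]] := sqrt_opp3_descent_step xyz.
  have coprm : coprimez (p%:Z ^+ n.+1) m.
    by rewrite coprimezXl // coprimezE prime_coprime // -dvdzE.
  have [xd yd zd] := IHn _ _ _ _ _ _ xyz'.
  by split; rewrite -(Gauss_dvdzr _ coprm) ?xn ?yn ?zn (exprS p%:Z); apply: dvdz_mul.
have n0 (a : int) : (forall n, p%:Z ^+ n %| a)%Z -> a = 0.
  move=> /(_ `|a|%N); rewrite dvdzE abszX /= => /dvdn_leq pa.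
  apply/eqP/negPn/negP; rewrite -absz_gt0 => /pa.
  by rewrite leqNgt ltn_expl ?prime_gt1.
by split; apply: n0 => n; have [] := pn n _ _ _ _ _ _ xyz.
Qed.
End Descent.

(** * The field Q(sqrt(-3)) *)

Section Eisenstein.

Variables (L : fieldExtType rat) (eps : L).
Hypothesis heps : 3.-primitive_root eps.
Let s : L := 2 * eps + 1.

Lemma intr_eq0_rat (m : int) : (m%:~R == 0 :> L) = (m == 0).
Proof. by rewrite -(rmorph_int (in_alg L)) fmorph_eq0 intr_eq0. Qed.

Lemma prim3_sum : eps ^+ 2 + eps + 1 = 0.
Proof.
have e1 : eps - 1 != 0.
  rewrite subr_eq0; apply: contraTneq heps => ->.
  by apply/negP => /prim_order_dvd/(_ 1%N); rewrite expr1 eqxx.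
apply: (mulfI e1); rewrite mulr0.
transitivity (eps ^+ 3 - 1); first by ring.
by rewrite prim_expr_order ?subrr.
Qed.

Lemma sqrt_opp3_sqr : s ^+ 2 = -3.
Proof.
transitivity (4 * (eps ^+ 2 + eps + 1) - 3); first by rewrite /s; ring.
by rewrite prim3_sum mulr0 sub0r.
Qed.

Lemma sqrt_opp3_indep (m n : int) : m%:~R + n%:~R * s = 0 -> m = 0 /\ n = 0.
Proof.
move=> mn; have : (m ^+ 2 + 3 * n ^+ 2)%:~R = 0 :> L.
  transitivity ((m%:~R + n%:~R * s) * (m%:~R - n%:~R * s)); last by rewrite mn mul0r.
  transitivity (m%:~R ^+ 2 - n%:~R ^+ 2 * s ^+ 2 : L); last by ring.
  by rewrite sqrt_opp3_sqr; ring.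
by move/eqP; rewrite intr_eq0_rat => /eqP; nia.
Qed.

Lemma mem_Eisenstein (x : L) : x \in <<1; eps>>%VS ->
  exists (d a b : int), d != 0 /\ d%:~R * x = a%:~R + b%:~R * s.
Proof.
move=> xF.
have [u [v xE]] : exists u v : rat, x = u%:A + v%:A * eps.
  have deg2 : (adjoin_degree 1%VS eps <= 2)%N.
    rewrite -ltnS -size_minPoly.
    have Psize : size ('X^2 + 'X + 1 : {poly L}) = 3%N.
      by rewrite -addrA size_polyDl ?size_polyXn // size_polyDl ?size_polyX ?size_poly1.
    rewrite -Psize dvdp_leq -?size_poly_eq0 ?Psize //.
    apply: minPoly_dvdp; first by rewrite !rpredD ?rpredX ?polyOverX ?rpred1.
    by rewrite /root !hornerE ?hornerXn prim3_sum.
  have /polyOver1P[P PE] := Fadjoin_polyOver 1%AS eps x.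
  exists P`_0, P`_1; rewrite -[LHS](Fadjoin_poly_eq xF).
  have := size_Fadjoin_poly 1%VS eps x; move=> /leq_trans/(_ deg2) /horner_coef_wide ->.
  by rewrite big_ord_recl big_ord1 /= expr0 mulr1 PE !coef_map.
(* From eps = (s - 1) / 2, u + v eps = (u - v / 2) + (v / 2) s; then clear denominators. *)
exists (2 * denq u * denq v), (2 * numq u * denq v - numq v * denq u), (numq v * denq u).
split; first by rewrite !mulf_neq0 ?denq_eq0.
have denqE w : (denq w)%:~R * w%:A = (numq w)%:~R :> L.
  rewrite -(rmorph_int (in_alg L)) -rmorphM /= mulrC -numqE.
  by rewrite -[RHS](rmorph_int (in_alg L)).
by rewrite xE /s !(rmorphM, rmorphB) /= -!denqE; ring.
Qed.

Lemma Eisenstein_anisotropic (p : nat) (q t : int) :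
  prime p -> odd p -> p != 3%N -> (p%:Z %| t ^+ 2 + 3)%Z ->
  (forall y : 'F_p, y ^+ 2 != q%:~R) ->
  anisotropic_on (mem <<1; eps>>%VS) p%:R q%:~R.
Proof.
move=> p_pr op p3 pt qN x y z.
have [s0 [m [sm pm]]] := sqrt_opp3_mod_p p_pr op p3 pt.
have ps : ~~ (p%:Z %| s0)%Z.
  apply: contra p3 => /dvdzP[k kE]; have : (p%:Z %| 3)%Z.
    apply/dvdzP; exists (m - k * s0).
    by rewrite -[LHS](addKr (s0 ^+ 2)) sm mulrDl mulNr mulrAC -kE; ring.
  by rewrite dvdzE /= dvdn_prime2.
move=> /mem_Eisenstein[dx [x0 [x1 [dx0 xE]]]] /mem_Eisenstein[dy [y0 [y1 [dy0 yE]]]].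
move=> /mem_Eisenstein[dz [z0 [z1 [dz0 zE]]]] xyz.
have clear0 (d a b : int) (w : L) : d != 0 -> d%:~R * w = a%:~R + b%:~R * s ->
    forall e : int, e != 0 -> (e * a) ^+ 2 + 3 * (e * b) ^+ 2 = 0 -> w = 0.
  move=> d0 wE e e0 ab0; have [a0 b0] : a = 0 /\ b = 0 by clear -e0 ab0; split; nia.
  by move/eqP: wE; rewrite a0 b0 mul0r addr0 mulf_eq0 intr_eq0_rat (negPf d0) => /eqP.
pose ex := dy * dz; pose ey := dx * dz; pose ez := dx * dy.
have ex0 : ex != 0 by rewrite mulf_neq0.
have ey0 : ey != 0 by rewrite mulf_neq0.
have ez0 : ez != 0 by rewrite mulf_neq0.
have [] := @sqrt_opp3_descent p q s0 m p_pr op sm pm ps qN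
  (ex * x0) (ex * x1) (ey * y0) (ey * y1) (ez * z0) (ez * z1).
  (* The equation over the common denominator dx dy dz reads A + 2 B s = 0, and independence of 1
     and [s] separates the two components required by the descent. *)
  pose A := (ez * z0) ^+ 2 - 3 * (ez * z1) ^+ 2
    - (p%:Z * ((ex * x0) ^+ 2 - 3 * (ex * x1) ^+ 2) + q * ((ey * y0) ^+ 2 - 3 * (ey * y1) ^+ 2)).
  pose B := ez * z0 * (ez * z1) - (p%:Z * (ex * x0 * (ex * x1)) + q * (ey * y0 * (ey * y1))).
  suff [] : A = 0 /\ 2 * B = 0.
    by move=> /subr0_eq -> /eqP; rewrite mulf_eq0 /= subr_eq0 => /eqP ->.
  apply: sqrt_opp3_indep.
  transitivity ((ez%:~R * (z0%:~R + z1%:~R * s)) ^+ 2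
    - p%:~R * (ex%:~R * (x0%:~R + x1%:~R * s)) ^+ 2
    - q%:~R * (ey%:~R * (y0%:~R + y1%:~R * s)) ^+ 2
    - (s ^+ 2 + 3) * ((ez%:~R * z1%:~R) ^+ 2 - p%:~R * (ex%:~R * x1%:~R) ^+ 2
      - q%:~R * (ey%:~R * y1%:~R) ^+ 2)).
    by rewrite /A /B; ring.
  rewrite sqrt_opp3_sqr addNr mul0r subr0 -xE -yE -zE.
  transitivity ((dx * dy * dz)%:~R ^+ 2 * (z ^+ 2 - (p%:R * x ^+ 2 + q%:~R * y ^+ 2))).
    by rewrite /ex /ey /ez; ring.
  by rewrite xyz subrr mulr0.
move=> /(clear0 _ _ _ _ dx0 xE _ ex0) -> /(clear0 _ _ _ _ dy0 yE _ ey0) ->.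
by move=> /(clear0 _ _ _ _ dz0 zE _ ez0) ->.
Qed.
End Eisenstein.

(** * The two implications *)

Lemma legendre_neq1 (m : int) (p : nat) (y : 'F_p) :
  prime p -> legendre m p != 1 -> m%:~R != 0 :> 'F_p -> y ^+ 2 != m%:~R.
Proof.
rewrite /legendre => p_pr + m0; rewrite -Fp_intr_eq0 // (negPf m0).
by case: existsP => // yN _; apply/negP => yE; case: yN; exists y.
Qed.

Lemma Fp_sqr_lift (p : nat) (y : 'F_p) (m : int) :
  prime p -> y ^+ 2 = m%:~R -> exists t, (p%:Z %| t ^+ 2 - m)%Z.
Proof.
move=> p_pr yE; exists (y : nat)%:Z.
have yZ : (y : nat)%:Z%:~R = y := natr_Zp y.
by rewrite -Fp_intr_eq0 // intrB rmorphXn /= yZ yE subrr.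
Qed.

Lemma legendre_eq1 (m : int) (p : nat) :
  prime p -> legendre m p = 1 -> ~~ (p%:Z %| m)%Z /\ exists t, (p%:Z %| t ^+ 2 - m)%Z.
Proof.
rewrite /legendre => p_pr; case: ifP => // /negbT pm; case: existsP => // -[y /eqP yE] _.
by split=> //; apply: Fp_sqr_lift yE.
Qed.

Lemma sqr3_modp (p : nat) : prime p -> p = 3 %[mod 4] -> legendre (- 3%:Z) p != 1 ->
  exists r : int, (p%:Z %| r ^+ 2 - 3)%Z.
Proof.
move=> p_pr p4 leg.
have [p3|p3] := eqVneq ((- 3%:Z)%:~R : 'F_p) 0.
  by exists 0; rewrite expr0n sub0r -Fp_intr_eq0 ?p3.
have [|y [yE|yE]] := @finField_sqr_or_opp 'F_p 3%:R; rewrite ?card_Fp //.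
  exact: (@Fp_sqr_lift p y 3).
have := legendre_neq1 y p_pr leg p3.
by rewrite yE rmorphN /= eqxx.
Qed.

(** Composing the sums of two squares a^2 + (s e)^2 and eps^2 + (eps^2)^2 = -1 gives [x] and [y]
    with x^2 + y^2 = p or 2p; in the second case (x + y) / 2 and (x - y) / 2 serve. *)
Lemma sum_two_squares_Eisenstein (L : fieldExtType rat) (eps : L) (p : nat) :
  3.-primitive_root eps ->
  prime p -> p = 3 %[mod 4] -> legendre (- 3%:Z) p != 1 ->
  exists u v : L, [/\ u \in <<1; eps>>%AS, v \in <<1; eps>>%VS & u ^+ 2 + v ^+ 2 = p%:R].
Proof.
move=> heps p_pr p4 leg.
have [r pr] := sqr3_modp p_pr p4 leg.
have [a [e ae]] := small_norm_sqrt3 p_pr pr.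
have epsF := memv_adjoin 1%AS eps.
have eps0 := prim3_sum heps.
pose s : L := 2 * eps + 1.
have sF : s \in <<1; eps>>%AS by rewrite rpredD ?rpred1 // rpredM // rpred_nat.
have s2 : s ^+ 2 = -3 := sqrt_opp3_sqr heps.
pose x := eps * a%:~R - eps ^+ 2 * s * e%:~R.
pose y := eps * s * e%:~R + eps ^+ 2 * a%:~R.
have xF : x \in <<1; eps>>%AS by rewrite rpredB ?rpredM ?rpredX ?rpred_int.
have yF : y \in <<1; eps>>%AS by rewrite rpredD ?rpredM ?rpredX ?rpred_int.
have xy : x ^+ 2 + y ^+ 2 = - (a ^+ 2 - 3 * e ^+ 2)%:~R.
  transitivity ((eps ^+ 2 + eps + 1) * (eps ^+ 2 - eps + 1) * (a%:~R ^+ 2 + s ^+ 2 * e%:~R ^+ 2)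
     - (a%:~R ^+ 2 + s ^+ 2 * e%:~R ^+ 2)); first by rewrite /x /y; ring.
  by rewrite eps0 s2; ring.
case: ae => ae.
  by exists x, y; split=> //; rewrite xy ae; ring.
have L2 : 2 != 0 :> L by rewrite (intr_eq0_rat L 2).
exists ((x + y) / 2), ((x - y) / 2); split.
- by apply: rpred_div; [apply: rpredD | apply: rpred_nat].
- by apply: rpred_div; [apply: rpredB | apply: rpred_nat].
transitivity ((x ^+ 2 + y ^+ 2) / 2); first by field.
by rewrite xy ae; field.
Qed.

(** The elements u + sqrt a and Z + X sqrt a have norms -v^2 and -b Y^2. Their product has norm b (Y
    v)^2, which is a zero of the form, nontrivial unless v or Y is 0; in those cases a is visibly a
    square. *)
Lemma isotropic_of_splittings (F0 : fieldType) (L : fieldExtType F0) (K : {subfield L})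
    (a b u v X Y Z : L) :
  a \in K -> u \in K -> v \in K -> X \in K -> Y \in K -> Z \in K -> X != 0 ->
  u ^+ 2 + v ^+ 2 = a -> a * X ^+ 2 = Z ^+ 2 + b * Y ^+ 2 -> ~ anisotropic_on (mem K) a b.
Proof.
move=> aK uK vK XK YK ZK X0 uv XYZ aniso.
have [v0|v0] := eqVneq v 0.
  have [||||/eqP] := aniso 1 0 u; rewrite ?rpred1 ?rpred0 ?oner_eq0 //.
  by rewrite -uv v0; ring.
have [Y0|Y0] := eqVneq Y 0.
  have [||||/eqP] := aniso X 0 Z; rewrite ?rpred0 ?(negPf X0) //.
  by rewrite XYZ Y0; ring.
have [|||| _ /eqP] := aniso (Z + X * u) (Y * v) (Z * u + a * X); rewrite ?rpredD ?rpredM //.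
  apply/eqP; rewrite -subr_eq0; apply/eqP.
  transitivity ((Z ^+ 2 - a * X ^+ 2) * (u ^+ 2 - a) - b * Y ^+ 2 * v ^+ 2); first by ring.
  by rewrite XYZ -uv; ring.
by rewrite mulf_eq0 (negPf Y0) (negPf v0).
Qed.


Theorem proposition6p4 (L : fieldExtType rat) (eps theta : L) (alpha : int)
  (F K : {subfield L}) (p q : nat)
  (heps : 3.-primitive_root eps)
  (hF : F = <<1; eps>>%AS)
  (halpha0 : alpha != 0) (halpha1 : alpha != 1) (halpha : cubefree alpha)
  (htheta : theta ^+ 3 = alpha%:~R)
  (hK : K = <<F; theta>>%AS)
  (hp : prime p) (hq : prime q) (op : odd p) (oq : odd q) (hpq : p != q)
  (hleg : legendre q%:Z p != 1)
  (hp4 : p = 3 %[mod 4]) (hq4 : q = 3 %[mod 4]) :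
  division_algebra (quaternion (p%:R : subvs_of K) (q%:R : subvs_of K))
  <-> legendre (- 3%:Z) p = 1.
Proof.
have pq_dvd : (q%:Z)%:~R != 0 :> 'F_p.
  by rewrite Fp_intr_eq0 // dvdzE dvdn_prime2.
have qN (y : 'F_p) : y ^+ 2 != (q%:Z)%:~R by exact: legendre_neq1.
rewrite quaternion_subvs_division; split=> [aniso | leg1].
  apply/eqP/negPn/negP => legN.
  have [u [v [uF vF uv]]] := sum_two_squares_Eisenstein heps hp hp4 legN.
  have [t qt] : exists t : int, (q%:Z %| t ^+ 2 - p%:Z)%Z.
    have [y yE] := sqr_reciprocity hp hq hp4 hq4 hpq qN.
    exact: (@Fp_sqr_lift q y p).
  (* As q is not a square modulo p and p = 3 modulo 4, -q is one. *)
  have [r pr] : exists r : int, (p%:Z %| r ^+ 2 + q%:Z)%Z.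
    have [|y [yE|yE]] := @finField_sqr_or_opp 'F_p q%:R; first by rewrite card_Fp.
      by case/eqP: (qN y).
    have [|r] := @Fp_sqr_lift p y (- q%:Z) hp; first by rewrite yE rmorphN.
    by rewrite opprK; exists r.
  have [X [Y [Z [X0 XYZ]]]] := legendre_two_primes hp hq hpq pr qt.
  have FK : {subset <<1; eps>>%AS <= K}.
    by apply/subvP; rewrite hK hF subv_adjoin.
  have intK (n : int) : n%:~R \in K by exact: rpred_int.
  apply: (isotropic_of_splittings (intK p) (FK _ uF) (FK _ vF) (intK X) (intK Y) (intK Z)
    _ uv _ aniso).
    by rewrite intr_eq0_rat.
  transitivity ((p%:Z * X ^+ 2)%:~R : L); first by ring.
  by rewrite XYZ; ring.
have [pN3 [t pt]] := legendre_eq1 hp leg1; rewrite opprK in pt.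
(* For p = 3 the symbol would be 0. *)
have p3 : p != 3%N by apply: contraNneq pN3 => ->.
have anisoF : anisotropic_on (mem F) (p%:R : L) q%:R.
  by rewrite hF; exact: (@Eisenstein_anisotropic L eps heps p q t).
rewrite hK; apply: (@cube_root_anisotropic _ L F p%:R q%:R alpha%:~R eps theta) => //.
- exact: rpred_nat.
- exact: rpred_nat.
- exact: rpred_int.
- by rewrite intr_eq0_rat.
- by rewrite hF memv_adjoin.
Qed.
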